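(* Let the factors $q(\bm u)$ and $q(\bm\theta,\bm\tau,\bm\pi,\bm\beta)$ and the parameters $\bm\xi$ be given, and let $q(\bm z,T)$ be the probability distribution determined by $$\ln q(\bm z,T)=\mathbb{E}_{q(\bm u)\,q(\bm\theta,\bm\tau,\bm\pi,\bm\beta)}\bigl[\ln\bigl(p(\bm x,\bm z,T,\bm\theta,\bm\tau,\bm\pi\mid\bm u)\,h(\bm u\mid\bm\beta,\bm\xi)\,p(\bm\beta)\bigr)\bigr]+\mathrm{const.},$$ where ''const.'' does not depend on $(\bm z,T)$. Put $q(s\preceq\mathsf{s}(\bm u_t)):=\mathbb{E}_{q(\bm u_t)}[I\{s\preceq\mathsf{s}(\bm u_t)\}]$ and, for $s\in\mathcal{S}_{\max}$ and $k\in\{1,\dots,K\}$, $$\ln\rho_{s,k}:=\mathbb{E}_{q(\bm\pi)}[\ln\pi_k]+\sum_{t=1}^n q(s\preceq\mathsf{s}(\bm u_t))\,\mathbb{E}_{q(\bm\theta,\bm\tau)}[\ln\mathcal{N}(x_t\mid\tilde{\bm x}_t^\top\bm\theta_k,\tau_k^{-1})],\qquad \pi'_{s,k}:=\frac{\rho_{s,k}}{\sum_{j=1}^K\rho_{s,j}}.$$ Then $q(\bm z,T)$ factorizes as $q(\bm z,T)=q(T)\prod_{s\in\mathcal{L}_T}q(\bm z_s)$, where $$q(\bm z_s)=\prod_{k=1}^K(\pi'_{s,k})^{z_{s,k}},\qquad q(T)=\Bigl(\prod_{s\in\mathcal{I}_T}g'_s\Bigr)\Bigl(\prod_{s\in\mathcal{L}_T}(1-g'_s)\Bigr),$$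 with $$g'_s:=\begin{cases}\dfrac{g_s\prod_{s_{\mathrm{ch}}\in\mathrm{Ch}(s)}\phi_{s_{\mathrm{ch}}}}{\phi_s}, & s\in\mathcal{I}_{\max},\\ 0, & s\in\mathcal{L}_{\max},\end{cases}$$ $$\phi_s:=\begin{cases}(1-g_s)\sum_{k=1}^K\rho_{s,k}+g_s\prod_{s_{\mathrm{ch}}\in\mathrm{Ch}(s)}\phi_{s_{\mathrm{ch}}}, & s\in\mathcal{I}_{\max},\\ \sum_{k=1}^K\rho_{s,k}, & s\in\mathcal{L}_{\max}.\end{cases}$$ Here $q(\bm u_t)$ is the marginal of $q(\bm u)$, and $q(\bm\pi)$ and $q(\bm\theta,\bm\tau)$ are marginals of $q(\bm\theta,\bm\tau,\bm\pi,\bm\beta)$.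
   Context: **Trees.** $T_{\max}$ is the perfect binary rooted tree of depth $D_{\max}\ge 1$ with root $s_\lambda$; $\mathcal{I}_{\max}$, $\mathcal{L}_{\max}$ are its sets of inner and leaf nodes, $\mathcal{S}_{\max}=\mathcal{I}_{\max}\cup\mathcal{L}_{\max}$. $d_s$ is the depth of $s$ ($d_{s_\lambda}=0$). For $s\in\mathcal{I}_{\max}$, $s_0,s_1$ are its left and right children, $\mathrm{Ch}(s)=\{s_0,s_1\}$. $s'\preceq s$ means $s'$ is an ancestor of $s$ or equals $s$. $\mathcal{T}$ is the set of all regular rooted subtrees $T$ of $T_{\max}$ with root $s_\lambda$ (each node of $T$ has, in $T$, either both children or none); $\mathcal{I}_T,\mathcal{L}_T$ are the inner and leaf nodes of $T$. $I\{\cdot\}$ is the indicator function. **Variables.** $\bm u=\{\bm u_t\}_{t=1}^n$, $\bm u_t=[u_{t,0},\dots,u_{t,D_{\max}-1}]^\top\in\{0,1\}^{D_{\max}}$; $\mathsf{s}(\bm u_t)\in\mathcal{L}_{\max}$ is the leaf reached from the root by taking at depth $d$ the right branch if $u_{t,d}=1$ and the left if $u_{t,d}=0$. $\bm z=\{\bm z_s\}_{s\in\mathcal{L}_T}$, each $\bm z_s\in\{0,1\}^K$ one-hot. $\bm\pi$ is a probability vector of length $K$. $\bm\theta=\{\bm\theta_k\}_{k=1}^K$, $\bm\theta_k\in\mathbb{R}^{D+1}$; $\bm\tau=\{\tau_k\}_{k=1}^K$, $\tau_k>0$. $\bm\beta=\{\bm\beta_s\}_{s\in\mathcal{I}_{\max}}$,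 $\bm\beta_s\in\mathbb{R}^2$. The data $\bm x=(x_1,\dots,x_n)^\top\in\mathbb{R}^n$ are fixed, $\tilde{\bm x}_t=[x_{t-1},\dots,x_{t-D},1]^\top$ (with $x_0,\dots,x_{1-D}$ given real numbers), $\tilde{\bm t}=[t,1]^\top$. **Model.** $p(\bm x,\bm z,T,\bm\theta,\bm\tau,\bm\pi\mid\bm u)=p(\bm x\mid\bm u,\bm z,\bm\theta,\bm\tau,T)\,p(\bm z\mid\bm\pi,T)\,p(T)\,p(\bm\pi)\,p(\bm\theta,\bm\tau)$ with - $p(\bm x\mid\bm u,\bm z,\bm\theta,\bm\tau,T)=\prod_{t=1}^n\prod_{s\in\mathcal{L}_T}\prod_{k=1}^K\mathcal{N}(x_t\mid\tilde{\bm x}_t^\top\bm\theta_k,\tau_k^{-1})^{z_{s,k}I\{s\preceq\mathsf{s}(\bm u_t)\}}$ ($\mathcal{N}(\cdot\mid m,v)$: normal density with mean $m$, variance $v$); - $p(\bm z\mid\bm\pi,T)=\prod_{s\in\mathcal{L}_T}\prod_{k=1}^K\pi_k^{z_{s,k}}$; - $p(T)=\prod_{s\in\mathcal{I}_T}g_s\prod_{s\in\mathcal{L}_T}(1-g_s)$, $g_s\in[0,1]$, $g_s=0$ for $s\in\mathcal{L}_{\max}$ (this is a probability distribution on $\mathcal{T}$); - $p(\bm\pi)=\mathrm{Dir}(\bm\pi\mid\bm\alpha)$, $\bm\alpha\in\mathbb{R}_{>0}^K$; - $p(\bm\theta,\bm\tau)=\prod_{k=1}^K\mathcal{N}(\bm\theta_k\mid\bm\mu,(\tau_k\bm\Lambda)^{-1})\,\mathrm{Gam}(\tau_k\mid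 a,b)$ ($\bm\Lambda$ positive definite, shape $a>0$, rate $b>0$); - $p(\bm\beta)=\prod_{s\in\mathcal{I}_{\max}}\mathcal{N}(\bm\beta_s\mid\bm\eta_s,\bm L_s^{-1})$ ($\bm L_s$ positive definite). **Local variational bound.** $\bm\xi=\{\xi_{s,t}\}$ are real parameters and $h(\bm u\mid\bm\beta,\bm\xi)=\prod_{t=1}^n\prod_{s\in\mathcal{I}_{\max}}h(u_{t,d_s}\mid\bm\beta_s,\xi_{s,t})^{I\{s\preceq\mathsf{s}(\bm u_t)\}}$, where $h(u\mid\bm\beta_s,\xi_{s,t})=\sigma(\xi_{s,t})\exp\{\bm\beta_s^\top\tilde{\bm t}\,u-\frac12(\bm\beta_s^\top\tilde{\bm t}+\xi_{s,t})-\lambda(\xi_{s,t})((\bm\beta_s^\top\tilde{\bm t})^2-\xi_{s,t}^2)\}$, $\sigma$ is the logistic sigmoid and $\lambda(\xi)=\frac1{2\xi}(\sigma(\xi)-\frac12)$ (with $\lambda(0)=1/8$). **Variational distribution.** The variational distribution has the form $q(\bm u)\,q(\bm z,T)\,q(\bm\theta,\bm\tau,\bm\pi,\bm\beta)$; the given factors are probability distributions for which the expectations in the definition of $\ln\rho_{s,k}$ are finite. Log-factors of the model not involving $(\bm z,T)$ are absorbed into ''const.''; $\ln 0=-\infty$ and $\exp(-\infty)=0$. *)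

(* Defs.v *)
From HB Require Import structures.
From mathcomp Require Import all_boot all_order all_algebra.
From mathcomp Require Import all_classical all_reals all_analysis.

Set Implicit Arguments.
Unset Strict Implicit.
Unset Printing Implicit Defensive.

Import Order.TTheory GRing.Theory Num.Theory.
Import numFieldNormedType.Exports.

Local Open Scope ring_scope.

(* A node of the perfect binary tree of depth Dmax is the sequence of branches
   (false = left, true = right) leading to it from the root. Thus its depth is
   its size, the root is [bseq], and "s is an ancestor of s' or equals s'" is
   [prefix s s']. *)
Definition node (Dmax : nat) := Dmax.-bseq bool.

Section Trees.
Variable Dmax : nat.

Definition Imax : {set node Dmax} := [set s : node Dmax | (size s < Dmax)%N].
Definition Lmax : {set node Dmax} := [set s : node Dmax | size s == Dmax].

Definition children (s : node Dmax) : {set node Dmax} :=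
  [set c : node Dmax | [exists b, bseqval c == rcons s b]].

Definition regular_subtree (A : {set node Dmax}) : bool :=
  [&& ([bseq] : node Dmax) \in A,
      [forall s : node Dmax, forall c in children s, (c \in A) ==> (s \in A)] &
      [forall s in A, (children s \subset A) || [disjoint children s & A]]].

Record tree := Tree {
  tree_nodes : {set node Dmax};
  _ : regular_subtree tree_nodes }.

HB.instance Definition _ := [isSub for tree_nodes].
HB.instance Definition _ := [Finite of tree by <:].

Definition leaves (T : tree) : {set node Dmax} :=
  [set s in tree_nodes T | [disjoint children s & tree_nodes T]].
Definition inners (T : tree) : {set node Dmax} := tree_nodes T :\: leaves T.

Definition leaf (T : tree) := {s : node Dmax | s \in leaves T}.
Definition inode := {s : node Dmax | s \in Imax}.

(* With the encoding of nodes by branch sequences, the leaf reached from the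
   root by branching right exactly at the depths d with u_d = 1 is u itself. *)
Definition reached_leaf (u : Dmax.-tuple bool) : node Dmax := bseq_of_tuple u.

End Trees.

HB.instance Definition _ (Dmax : nat) (T : tree Dmax) := Finite.on (leaf T).
HB.instance Definition _ (Dmax : nat) := Finite.on (inode Dmax).

Definition onehot (K : nat) :=
  {v : {ffun 'I_K -> bool} | (\sum_k v k == 1)%N}.
HB.instance Definition _ (K : nat) := Finite.on (onehot K).

(* The values of z = {z_s}_{s in L_T}; their type depends on T. *)
Definition latent (Dmax K : nat) (T : tree Dmax) := {ffun leaf T -> onehot K}.
HB.instance Definition _ Dmax K (T : tree Dmax) := Finite.on (latent K T).

(* u = {u_t}; the index t : 'I_n stands for the time t.+1. *)
Definition paths (Dmax n : nat) := {ffun 'I_n -> Dmax.-tuple bool}.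
HB.instance Definition _ Dmax n := Finite.on (paths Dmax n).

Section Densities.
Variable R : realType.

Definition posdef (d : nat) (A : 'M[R]_d) : Prop :=
  A^T = A /\ forall v : 'cV[R]_d, v != 0 -> 0 < (v^T *m A *m v) 0 0.

(* [normal_pdf] takes the standard deviation, N(. | m, v) the variance. *)
Definition gauss (m v x : R) : R := normal_pdf m (Num.sqrt v) x.

Definition mvgauss (d : nat) (m : 'cV[R]_d) (S : 'M[R]_d) (x : 'cV[R]_d) : R :=
  (Num.sqrt ((2 * pi) ^+ d * \det S))^-1 *
  expR (- (2^-1 * ((x - m)^T *m invmx S *m (x - m)) 0 0)).

Definition Gamma (a : R) : R :=
  (\int[lebesgue_measure]_(t in `]0%R, +oo[) (t `^ (a - 1) * expR (- t)))%R.

Definition gamma_pdf (a b t : R) : R :=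
  b `^ a / Gamma a * t `^ (a - 1) * expR (- (b * t)).

(* Density of Dir(alpha) on the simplex; it is only evaluated there. *)
Definition dirichlet_pdf (K : nat) (alpha p : 'I_K -> R) : R :=
  Gamma (\sum_k alpha k) / (\prod_k Gamma (alpha k)) *
  \prod_k p k `^ (alpha k - 1).

Definition sigmoid (y : R) : R := (1 + expR (- y))^-1.
Definition lambda (y : R) : R :=
  if y == 0 then 8^-1 else (2 * y)^-1 * (sigmoid y - 2^-1).

End Densities.

Section Model.
Variables (R : realType) (Dmax n K D : nat).

(* The space of (theta, tau, pi, beta), with the product sigma-algebra. The
   constraints on tau and pi are imposed on distributions in [admissible]. *)
Definition theta_space : measurableType _ := K.-tuple (D.+1.-tuple R).
Definition tau_space : measurableType _ := K.-tuple R.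
Definition pi_space : measurableType _ := K.-tuple R.
Definition beta_space : measurableType _ :=
  #|{: inode Dmax}|.-tuple (2.-tuple R).
Definition thetatau_space : measurableType _ := (theta_space * tau_space)%type.
Definition param_space : measurableType _ :=
  ((thetatau_space * pi_space) * beta_space)%type.

Definition get_thetatau (w : param_space) : thetatau_space := w.1.1.
Definition get_pi (w : param_space) : pi_space := w.1.2.

Definition colvec (d : nat) (v : d.-tuple R) : 'cV[R]_d := \col_i tnth v i.

Definition theta_k (tt : thetatau_space) (k : 'I_K) : 'cV[R]_D.+1 :=
  colvec (tnth tt.1 k).
Definition tau_k (tt : thetatau_space) (k : 'I_K) : R := tnth tt.2 k.
Definition pi_k (p : pi_space) (k : 'I_K) : R := tnth p k.
Definition beta_s (w : param_space) (s : inode Dmax) : 'cV[R]_2 :=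
  colvec (tnth w.2 (enum_rank s)).

Definition admissible (w : param_space) : Prop :=
  [/\ forall k, 0 < tau_k (get_thetatau w) k,
      forall k, 0 <= pi_k (get_pi w) k &
      \sum_k pi_k (get_pi w) k = 1].

(* The series x : int -> R holds the observations x_1, ..., x_n and the initial
   values x_0, ..., x_{1-D}; its other values are irrelevant. *)
Definition obs (x : int -> R) (t : 'I_n) : R := x t.+1%:Z.
Definition regressor (x : int -> R) (t : 'I_n) : 'cV[R]_D.+1 :=
  \col_(i < D.+1) if (i < D)%N then x (t.+1%:Z - i.+1%:Z) else 1.
Definition time_vec (t : 'I_n) : 'cV[R]_2 :=
  \col_(i < 2) if i == 0 then t.+1%:R else 1.

(* N(x_t | tilde x_t^T theta_k, tau_k^{-1}) *)
Definition lik (x : int -> R) (t : 'I_n) (k : 'I_K)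
    (tt : thetatau_space) : R :=
  gauss (((regressor x t)^T *m theta_k tt k) 0 0) (tau_k tt k)^-1 (obs x t).

Definition p_x (x : int -> R) (u : paths Dmax n) (T : tree Dmax)
    (z : latent K T) (w : param_space) : R :=
  \prod_(t < n) \prod_(s : leaf T) \prod_(k < K)
    lik x t k (get_thetatau w) ^+
      (val (z s) k * prefix (val s) (reached_leaf (u t)))%N.

Definition p_z (T : tree Dmax) (z : latent K T) (w : param_space) : R :=
  \prod_(s : leaf T) \prod_(k < K) pi_k (get_pi w) k ^+ val (z s) k.

Definition tree_prior (g : node Dmax -> R) (T : tree Dmax) : R :=
  (\prod_(s in inners T) g s) * \prod_(s in leaves T) (1 - g s).

Definition p_thetatau (mu : 'cV[R]_D.+1) (Lambda : 'M[R]_D.+1) (a b : R)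
    (w : param_space) : R :=
  \prod_(k < K)
    (mvgauss mu (invmx (tau_k (get_thetatau w) k *: Lambda))
       (theta_k (get_thetatau w) k) *
     gamma_pdf a b (tau_k (get_thetatau w) k)).

Definition p_beta (eta : inode Dmax -> 'cV[R]_2) (L : inode Dmax -> 'M[R]_2)
    (w : param_space) : R :=
  \prod_(s : inode Dmax) mvgauss (eta s) (invmx (L s)) (beta_s w s).

Definition h_factor (v : bool) (bt xi : R) : R :=
  sigmoid xi *
  expR (bt * v%:R - 2^-1 * (bt + xi) - lambda xi * (bt ^+ 2 - xi ^+ 2)).

Definition h_bound (xi : inode Dmax -> 'I_n -> R) (u : paths Dmax n)
    (w : param_space) : R :=
  \prod_(t < n) \prod_(s : inode Dmax)
    h_factor (nth false (u t) (size (val s)))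
      (((beta_s w s)^T *m time_vec t) 0 0) (xi s t) ^+
        prefix (val s) (reached_leaf (u t)).

Definition joint (x : int -> R) (g : node Dmax -> R) (alpha : 'I_K -> R)
    (mu : 'cV[R]_D.+1) (Lambda : 'M[R]_D.+1) (a b : R) (u : paths Dmax n)
    (T : tree Dmax) (z : latent K T) (w : param_space) : R :=
  p_x x u z w * p_z z w * tree_prior g T *
  dirichlet_pdf alpha (pi_k (get_pi w)) * p_thetatau mu Lambda a b w.

End Model.

Section Variational.
Variables (R : realType) (Dmax n K D : nat).
Variable qu : paths Dmax n -> R.
Variable qpar : probability (param_space R Dmax K D) R.
Local Open Scope ereal_scope.

Definition marg_u (t : 'I_n) (v : Dmax.-tuple bool) : R :=
  (\sum_(u : paths Dmax n | u t == v) qu u)%R.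
Definition marg_pi := pushforward qpar (@get_pi R Dmax K D).
Definition marg_thetatau := pushforward qpar (@get_thetatau R Dmax K D).

Definition q_path (s : node Dmax) (t : 'I_n) : R :=
  (\sum_(v : Dmax.-tuple bool) marg_u t v * (prefix s (reached_leaf v))%:R)%R.

Definition ln_rho (x : int -> R) (s : node Dmax) (k : 'I_K) : \bar R :=
  \int[marg_pi]_p lne (pi_k p k)%:E +
  \sum_(t < n) (q_path s t)%:E *
    \int[marg_thetatau]_tt lne (lik x t k tt)%:E.

Definition rho (x : int -> R) (s : node Dmax) (k : 'I_K) : R :=
  fine (expeR (ln_rho x s k)).

Definition pi' (x : int -> R) (s : node Dmax) (k : 'I_K) : R :=
  (rho x s k / \sum_(j < K) rho x s j)%R.

End Variational.

Section Recursion.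
Variables (R : realType) (Dmax K : nat).
Variables (g : node Dmax -> R) (r : node Dmax -> 'I_K -> R).

Fixpoint phi_rec (h : nat) (s : node Dmax) : R :=
  if h is h'.+1 then
    (1 - g s) * (\sum_(k < K) r s k) +
    g s * \prod_(c in children s) phi_rec h' c
  else \sum_(k < K) r s k.

(* The recursion runs on the height Dmax - d_s of s; [phiE] and [phi_leafE] are
   its defining equations. *)
Definition phi (s : node Dmax) : R := phi_rec (Dmax - size s) s.

Lemma phiE (s : node Dmax) : s \in Imax Dmax ->
  phi s = (1 - g s) * (\sum_(k < K) r s k) +
          g s * \prod_(c in children s) phi c.
Proof.
rewrite inE => ltsD; rewrite {1}/phi -[(Dmax - _)%N](subnSK ltsD) /=.
congr (_ + _ * _); apply: eq_bigr => c; rewrite inE => /existsP[b /eqP eqc].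
by rewrite /phi eqc size_rcons.
Qed.

Lemma phi_leafE (s : node Dmax) : s \in Lmax Dmax ->
  phi s = \sum_(k < K) r s k.
Proof. by rewrite inE /phi => /eqP ->; rewrite subnn. Qed.

Definition g' (s : node Dmax) : R :=
  if s \in Imax Dmax then g s * (\prod_(c in children s) phi c) / phi s else 0.

End Recursion.

(* Main.v *)
(* Only ln p(x | u, z, ...), ln p(z | pi, T) and ln p(T) vary with (z, T), and
   their expectations add up to ln p(T) + sum_s sum_k z_{s,k} ln rho_{s,k}.
   Comparing with a configuration (T0, z0) of positive probability, for which
   the whole expectation is necessarily finite, gives
   q(z, T) ~ p(T) prod_{s,k} rho_{s,k}^{z_{s,k}} without integrability of
   the absorbed factors. Normalising rho at each leaf s produces a factor
   sum_k rho_{s,k}; writing p(T) prod_s sum_k rho_{s,k} in terms of g', the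
   factors phi telescope along T down to phi at the root. Both the claimed
   formula and q sum to 1, so the proportionality constant is 1. *)
Require Import Defs.
From HB Require Import structures.
From mathcomp Require Import all_boot all_order all_algebra.
From mathcomp Require Import all_classical all_reals all_analysis.
From mathcomp Require Import ring measurable_realfun.

Set Implicit Arguments.
Unset Strict Implicit.
Unset Printing Implicit Defensive.

Import Order.TTheory GRing.Theory Num.Theory.
Import numFieldNormedType.Exports.

Local Open Scope ring_scope.

(** * Combinatorics of regular subtrees and the total mass of the tree prior *)

Lemma prefix_rconsE (A : eqType) (t s : seq A) (v : A) :
  prefix t (rcons s v) = (t == rcons s v) || prefix t s.
Proof.
apply/idP/orP => [/prefixP[s']|[/eqP ->|]]; last 2 first.
- exact: prefix_refl.
- by move=> /prefix_trans; apply; exact: prefix_rcons.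
case/lastP: s' => [|s' y]; first by rewrite cats0 => ->; left.
by rewrite -rcons_cat => /rcons_inj[-> _]; right; exact: prefix_prefix.
Qed.

Section Nodes.
Variable Dmax : nat.
Implicit Types (s t c p : node Dmax) (T : tree Dmax).

Lemma childrenP s c :
  reflect (exists b, c = rcons s b :> seq bool) (c \in children s).
Proof.
rewrite inE; apply: (iffP existsP) => -[b] => [/eqP|] cE; exists b => //.
exact/eqP.
Qed.

Lemma children_inj p p' c : c \in children p -> c \in children p' -> p = p'.
Proof.
move=> /childrenP[b cE] /childrenP[b']; rewrite cE => /rcons_inj[pE _].
exact: val_inj.
Qed.

Lemma size_child p c : c \in children p -> size c = (size p).+1.
Proof. by move=> /childrenP[b ->]; rewrite size_rcons. Qed.

Lemma root_notin_children p : ([bseq] : node Dmax) \notin children p.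
Proof. by apply/negP => /size_child. Qed.

(** Induction from the root downwards, the direction in which [compatible_open_tree] recovers a tree
    from its marks. *)
Lemma node_ind (P : node Dmax -> Prop) :
  P [bseq] -> (forall p c, c \in children p -> P p -> P c) -> forall s, P s.
Proof.
move=> P0 PS [s]; elim/last_ind: s => [|s b IH] ltsD.
  by rewrite (_ : Bseq _ = [bseq])//; exact: val_inj.
have ltsD' : (size s <= Dmax)%N by rewrite ltnW// -(size_rcons s b).
by apply: (PS (Bseq ltsD')); [apply/childrenP; exists b|exact: IH].
Qed.

Lemma children_nonempty s : s \in Imax Dmax -> exists c, c \in children s.
Proof.
rewrite inE => ltsD.
have ltrD : (size (rcons s false) <= Dmax)%N by rewrite size_rcons.
by exists (Bseq ltrD); apply/childrenP; exists false.
Qed.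

Lemma notin_Imax s : (s \notin Imax Dmax) = (s \in Lmax Dmax).
Proof. by rewrite !inE -leqNgt eqn_leq size_bseq. Qed.

Lemma root_in_tree T : [bseq] \in tree_nodes T.
Proof. by case: T => A /= /and3P[]. Qed.

Lemma parent_in_tree T p c :
  c \in children p -> c \in tree_nodes T -> p \in tree_nodes T.
Proof.
case: T => A /= /and3P[_ /forallP/(_ p)/forall_inP cA _] cp.
exact/implyP/cA.
Qed.

Lemma inners_children T s :
  s \in inners T -> children s \subset tree_nodes T.
Proof.
rewrite !inE => /andP[+ sT]; rewrite sT /=.
by case: T sT => A /= /and3P[_ _ /forall_inP sA] /sA /orP[->//|->].
Qed.

Lemma parent_inners T p c :
  c \in children p -> c \in tree_nodes T -> p \in inners T.
Proof.
move=> cp cT; rewrite !inE (parent_in_tree cp cT) andbT /=.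
by apply/negP => /pred0P /(_ c) /=; rewrite cp cT.
Qed.

Lemma leaves_sub T s : s \in leaves T -> s \in tree_nodes T.
Proof. by rewrite inE => /andP[]. Qed.

Lemma inners_Imax T s : s \in inners T -> s \in Imax Dmax.
Proof.
rewrite inE => /andP[+ sT]; rewrite inE sT /= => /pred0Pn[c /= /andP[cs _]].
by rewrite inE -(size_child cs) size_bseq.
Qed.

(** A deepest node of [T] is a leaf, since the children of an inner node lie in [T] and are deeper.
    This yields [0 < K] in the theorem. *)
Lemma leaves_nonempty T : exists s, s \in leaves T.
Proof.
have [s sT smax] := @arg_maxnP _ [bseq] (mem (tree_nodes T))
  (fun s : node Dmax => size s) (root_in_tree T).
exists s; apply: contraT => sNl.
have sI : s \in inners T by rewrite inE sNl.
have [c cs] := children_nonempty (inners_Imax sI).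
have /fintype.subsetP/(_ c cs) cT := inners_children sI.
by have := smax c cT; rewrite (size_child cs) /= ltnn.
Qed.

(** [b] marks nodes as open or closed. Only proper ancestors are tested, so a closed node still
    belongs to the set when everything above it is open; it is then a leaf. *)
Definition open_nodes (b : {ffun node Dmax -> bool}) : {set node Dmax} :=
  [set s : node Dmax |
    [forall t : node Dmax, (prefix t s && (t != s)) ==> b t]].

Lemma open_nodes_root b : [bseq] \in open_nodes b.
Proof.
rewrite inE; apply/forallP => t; apply/implyP => /andP[].
by rewrite prefixs0 => /eqP t0 /eqP; case; exact: val_inj.
Qed.

(** The proper ancestors of a child are its parent and the proper ancestors of that parent. With the
    case of the root, this recursion determines [open_nodes]. *)
Lemma open_nodes_child b p c : c \in children p ->
  (c \in open_nodes b) = b p && (p \in open_nodes b).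
Proof.
move=> cp; have szc := size_child cp; have /childrenP[v cE] := cp.
rewrite [in LHS]inE [X in _ && X]inE; apply/forallP/andP.
  move=> bc; split.
    apply: (implyP (bc p)); rewrite cE prefix_rcons /=.
    by apply/eqP => pc; move: szc; rewrite pc; exact: n_Sn.
  apply/forallP => t; apply/implyP => /andP[tp _]; apply: (implyP (bc t)).
  rewrite cE prefix_rconsE tp orbT /=; apply/eqP => tc.
  by have := size_prefix tp; rewrite tc szc ltnn.
move=> [bp /forallP bs] t; apply/implyP.
rewrite cE prefix_rconsE => /andP[/orP[/eqP tc|tp] tNc].
  by case/eqP: tNc; apply: val_inj; rewrite /= tc cE.
by have [->//|tNp] := eqVneq t p; apply: (implyP (bs t)); rewrite tp.
Qed.

Lemma open_nodes_regular b : regular_subtree (open_nodes b).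
Proof.
apply/and3P; split; first exact: open_nodes_root.
  apply/forallP => p; apply/forall_inP => c cp; apply/implyP.
  by rewrite (open_nodes_child b cp) => /andP[].
apply/forall_inP => p pb; apply/orP; case: (boolP (b p)) => bp; [left|right].
  by apply/fintype.subsetP => c cp; rewrite (open_nodes_child b cp) bp.
apply/pred0P => c /=; apply/negP => /andP[cp].
by rewrite (open_nodes_child b cp) (negbTE bp).
Qed.

Definition open_tree b : tree Dmax := Tree (open_nodes_regular b).

(** Marks outside [T] are left free, so compatibility is a separate condition at each node and sums
    over compatible markings factorize. *)
Definition compatible T s (v : bool) : bool :=
  ((s \in inners T) ==> v) && ((s \in leaves T) ==> ~~ v).

(** Going down from the root, the mark of a node in the tree decides whether its children belong to
    it, so a marking fits exactly one tree. Nodes of maximal depth are always leaves, hence must be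
    closed. *)
Lemma compatible_open_tree (b : {ffun node Dmax -> bool}) :
  (forall s, s \in Lmax Dmax -> ~~ b s) ->
  forall T, (b \in family (compatible T)) = (T == open_tree b).
Proof.
move=> bL T; apply/familyP/eqP => [bT|-> s]; last first.
  rewrite unfold_in /compatible; apply/andP; split; apply/implyP.
    rewrite !inE => /andP[+ sb]; rewrite sb /= => /pred0Pn[c /= /andP[cs]].
    by rewrite (open_nodes_child b cs) => /andP[].
  rewrite inE /= => /andP[sb /pred0P nc].
  case: (boolP (s \in Imax Dmax)) => [/children_nonempty[c cs]|]; last first.
    by rewrite notin_Imax; exact: bL.
  by have := nc c; rewrite /= cs (open_nodes_child b cs) sb andbT => /= ->.
have {}bT s : compatible T s (b s) by exact: bT.
apply: val_inj; apply/setP; elim/node_ind => [|p c cp IH].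
  by rewrite open_nodes_root root_in_tree.
rewrite /= (open_nodes_child b cp); apply/idP/andP => [cT|[bp pb]].
  split; last by rewrite -IH; exact: parent_in_tree cp cT.
  by have /andP[/implyP->//] := bT p; exact: parent_inners cp cT.
have pT : p \in tree_nodes T by rewrite IH.
have /andP[_ /implyP bl] := bT p.
suff /inners_children/fintype.subsetP/(_ c cp) : p \in inners T by [].
by rewrite inE pT andbT; apply/negP => /bl; rewrite bp.
Qed.

(* Opening every node s independently with probability g s, the nodes whose
   proper ancestors are all open form a random tree with law tree_prior g. *)
Lemma sum_tree_prior (R : realType) (g : node Dmax -> R) :
  (forall s, s \in Lmax Dmax -> g s = 0) -> \sum_T tree_prior g T = 1.
Proof.
move=> g0; pose w s (v : bool) := if v then g s else 1 - g s.
have w1 s : \sum_v w s v = 1 by rewrite big_bool /w /= addrC subrK.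
(* An inner node contributes [g s], a leaf [1 - g s], and a node outside [T] the full sum
   [w s true + w s false = 1]. *)
have priorE T : tree_prior g T = \prod_s \sum_(v | compatible T s v) w s v.
  rewrite /tree_prior [RHS](bigID [in inners T]) /=; congr (_ * _).
    apply: eq_bigr => s sI; rewrite (big_pred1 true)// => v.
    have sL : (s \in leaves T) = false.
      by apply/negbTE; move: sI; rewrite inE => /andP[].
    by rewrite /compatible sI sL andbT /= eqb_id.
  rewrite [RHS](bigID [in leaves T]) /= [X in _ = _ * X]big1 ?mulr1.
    apply: eq_big => s /=.
      have -> : (s \in inners T) = (s \notin leaves T) && (s \in tree_nodes T).
        by rewrite inE.
      by case: (boolP (s \in leaves T)) => //= _; rewrite andbF.
    move=> sL; rewrite (big_pred1 false)// => v.
    by rewrite /compatible inE sL /= eqbF_neg.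
  move=> s /andP[sI sL]; rewrite -(w1 s); apply: eq_bigl => v.
  by rewrite /compatible (negbTE sI) (negbTE sL).
under eq_bigr do rewrite priorE bigA_distr_big_dep.
rewrite (exchange_big_dep xpredT)//=.
transitivity (\sum_(b : {ffun node Dmax -> bool}) \prod_s w s (b s));
  last first.
  by rewrite -(bigA_distr_bigA w); apply: big1.
apply: eq_bigr => b _.
(* A marking that opens a node of maximal depth has weight 0, because [g] vanishes there; any other
   marking is counted for exactly one tree. *)
have [/existsP[s /andP[sL bs]]|] :=
    boolP [exists s, (s \in Lmax Dmax) && b s].
  have -> : \prod_s w s (b s) = 0.
    by rewrite (bigD1 s)//= /w bs g0// mul0r.
  by rewrite big1.
rewrite negb_exists => /forallP bL; apply: big_pred1 => T.
apply: compatible_open_tree => s sL.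
by have := bL s; rewrite sL.
Qed.

(** Each node of [T] other than the root is a child of exactly one inner node. This regrouping is
    what lets the factors [phi] telescope. *)
Lemma prod_inners_children (R : realType) (f : node Dmax -> R) T :
  \prod_(s in inners T) \prod_(c in children s) f c =
  \prod_(s in tree_nodes T | s != [bseq]) f s.
Proof.
rewrite (exchange_big_dep (fun c => (c \in tree_nodes T) && (c != [bseq])))/=.
  apply: eq_bigr => c; elim/node_ind: c => [/andP[_]|p c cp _ /andP[cT _]].
    by rewrite eqxx.
  apply: big_pred1 => s /=; apply/andP/eqP => [[_ cs]|->].
    exact: children_inj cs cp.
  by split=> //; exact: parent_inners cp cT.
move=> s c /inners_children/fintype.subsetP sT cs; rewrite sT//=.
by apply: contraTneq cs => ->; exact: root_notin_children.
Qed.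

End Nodes.

(** * One-hot vectors as indices *)

Section OneHot.
Variables (R : comNzRingType) (K : nat).
Implicit Types (f : 'I_K -> R) (v : onehot K).

Lemma onehot_subproof (k : 'I_K) :
  (\sum_j ([ffun i => i == k] : {ffun 'I_K -> bool}) j == 1)%N.
Proof.
apply/sum_nat_eq1; exists k; split; rewrite ?ffunE ?eqxx// => j jk _.
by rewrite ffunE (negbTE jk).
Qed.

Definition onehot_at (k : 'I_K) : onehot K :=
  exist (fun v : {ffun 'I_K -> bool} => is_true (\sum_j v j == 1)%N) _
    (onehot_subproof k).

Lemma onehotP v : exists k, v = onehot_at k.
Proof.
have /sum_nat_eq1[k [_ vk v0]] := valP v; exists k; apply: val_inj.
apply/ffunP => j; rewrite /= ffunE; have [->|jk] := eqVneq j k.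
  by move: vk => /=; case: (sval v k).
by have := v0 j jk isT; rewrite /=; case: (sval v j).
Qed.

Lemma prod_onehot_at f k : \prod_(j < K) f j ^+ val (onehot_at k) j = f k.
Proof.
rewrite (bigD1 k)//= ffunE eqxx expr1 big1 ?mulr1// => j jk.
by rewrite ffunE (negbTE jk) expr0.
Qed.

Lemma sum_onehot f :
  \sum_(v : onehot K) \prod_(k < K) f k ^+ val v k = \sum_k f k.
Proof.
have /choice[pos posE] := onehotP.
have posK : cancel onehot_at pos.
  move=> k; have /(congr1 (fun v => val v k)) := posE (onehot_at k).
  by rewrite /= !ffunE eqxx => /esym/eqP.
rewrite (reindex onehot_at); last by apply: onW_bij; exists pos.
by apply: eq_bigr => k _; rewrite prod_onehot_at.
Qed.

End OneHot.

(** * Positivity of [phi], telescoping, and the normalised posterior *)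

Section Recursion.
Variables (R : realType) (Dmax K : nat).
Variables (g : node Dmax -> R) (r : node Dmax -> 'I_K -> R).
Hypotheses (hg : forall s, 0 <= g s <= 1) (K_gt0 : (0 < K)%N).
Hypotheses (hgleaf : forall s, s \in Lmax Dmax -> g s = 0).
Hypothesis (r_gt0 : forall s k, 0 < r s k).

Lemma sum_weight_gt0 s : 0 < \sum_k r s k.
Proof.
rewrite (bigD1 (Ordinal K_gt0))//= ltr_wpDr ?r_gt0// sumr_ge0// => k _.
exact: ltW.
Qed.

Lemma phi_gt0 s : 0 < phi g r s.
Proof.
rewrite /phi; move: (Dmax - size s)%N => h.
elim: h s => [|h IH] s /=; first exact: sum_weight_gt0.
have /andP[g_ge0 g_le1] := hg s.
have : 0 < \prod_(c in children s) phi_rec g r h c by exact: prodr_gt0.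
set P := \prod_(c in _) _ => P_gt0; have S_gt0 := sum_weight_gt0 s.
(* Either weight [1 - g s] or [g s] may vanish, but not both: the first summand is positive if
   [g s = 0], the second otherwise. *)
have [->|g_neq0] := eqVneq (g s) 0; first by rewrite subr0 mul1r mul0r addr0.
rewrite ltr_wpDl ?mulr_ge0 ?subr_ge0// ?ltW// mulr_gt0//.
by rewrite lt_neqAle eq_sym g_neq0.
Qed.

(** For an inner node of the maximal tree, the right side is the summand of [phi] complementary to
    the numerator of [g']. At maximal depth both sides are 1, so the formula covers all leaves of a
    tree uniformly. *)
Lemma g'_leaf s : 1 - g' g r s = (1 - g s) * (\sum_k r s k) / phi g r s.
Proof.
have phi_neq0 : phi g r s != 0 by rewrite gt_eqF// phi_gt0.
rewrite /g'; case: ifPn => [sI|]; last first.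
  rewrite notin_Imax => sL; rewrite hgleaf//.
  rewrite !subr0 mul1r -(phi_leafE g)// divff//.
by rewrite -{1}(divff phi_neq0) -mulrBl {1}phiE// addrK.
Qed.

Lemma tree_prior_g' (T : tree Dmax) :
  tree_prior (g' g r) T =
  tree_prior g T * (\prod_(s in leaves T) \sum_k r s k) / phi g r [bseq].
Proof.
have phi_neq0 s : phi g r s != 0 by rewrite gt_eqF// phi_gt0.
(* Both sides are the product of [phi] over all nodes of [T], split into inner nodes and leaves, or
   into the root and the children of inner nodes. *)
have phi_split : \prod_(s in inners T) phi g r s *
    \prod_(s in leaves T) phi g r s =
    phi g r [bseq] * \prod_(s in inners T) \prod_(c in children s) phi g r c.
  rewrite prod_inners_children -(bigD1 [bseq]) ?root_in_tree//=.
  rewrite [RHS](bigID [in leaves T]) /= mulrC; congr (_ * _).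
    apply: eq_bigl => s; rewrite [in RHS]andb_idl//; exact: leaves_sub.
  by apply: eq_bigl => s; rewrite finset.inE andbC.
have -> : tree_prior (g' g r) T =
    (\prod_(s in inners T) g s *
       (\prod_(s in inners T) \prod_(c in children s) phi g r c) /
       \prod_(s in inners T) phi g r s) *
    (\prod_(s in leaves T) (1 - g s) * (\prod_(s in leaves T) \sum_k r s k) /
       \prod_(s in leaves T) phi g r s).
  rewrite /tree_prior -!prodfV -!big_split /=; congr (_ * _).
    by apply: eq_bigr => s /inners_Imax sI; rewrite /g' sI.
  by apply: eq_bigr => s _; rewrite g'_leaf.
have c_neq0 : \prod_(s in inners T) \prod_(c in children s) phi g r c != 0.
  by apply/prodf_neq0 => s _; apply/prodf_neq0.
rewrite mulf_div phi_split /tree_prior; move: c_neq0 (phi_neq0 [bseq]).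
move: (\prod_(s in inners T) \prod_(c in _) _) (phi _ _ _) => c p c0 p0.
by field; rewrite p0.
Qed.

Definition latent_weight (T : tree Dmax) (z : latent K T) : R :=
  \prod_(s : leaf T) \prod_(k < K) r (val s) k ^+ val (z s) k.

(** The claimed form of q(z, T), with [r] in the role of [rho]. *)
Definition posterior (T : tree Dmax) (z : latent K T) : R :=
  tree_prior (g' g r) T *
  \prod_(s : leaf T) \prod_(k < K)
    (r (val s) k / \sum_j r (val s) j) ^+ val (z s) k.

(** The leaf sums gained in [tree_prior_g'] cancel the normalisation of the weights at the leaves;
    what remains is a constant multiple of the unnormalised weight. *)
Lemma posteriorE (T : tree Dmax) (z : latent K T) :
  posterior z = tree_prior g T * latent_weight z / phi g r [bseq].
Proof.
have S_neq0 s : \sum_k r s k != 0 by rewrite gt_eqF// sum_weight_gt0.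
rewrite /posterior tree_prior_g'.
have -> : \prod_(s : leaf T) \prod_(k < K)
      (r (val s) k / \sum_j r (val s) j) ^+ val (z s) k =
    latent_weight z / \prod_(s in leaves T) \sum_k r s k.
  rewrite [in RHS](big_sub (leaves T)) -prodfV -big_split /=.
  apply: eq_bigr => s _; have [k ->] := onehotP (z s).
  by rewrite !prod_onehot_at.
have : \prod_(s in leaves T) \sum_k r s k != 0 by apply/prodf_neq0.
have : phi g r [bseq] != 0 by rewrite gt_eqF// phi_gt0.
move: (phi _ _ _) (\prod_(s in leaves T) _) => c p c_neq0 p_neq0.
by field; rewrite c_neq0 p_neq0.
Qed.

(** For fixed [T] the sum over [z] splits into one factor per leaf, each equal to 1; the sum over
    [T] is [sum_tree_prior] applied to [g'], which vanishes at maximal depth. *)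
Lemma sum_posterior : \sum_T \sum_(z : latent K T) posterior z = 1.
Proof.
rewrite -(@sum_tree_prior _ R (g' g r)); last first.
  by move=> s; rewrite -notin_Imax /g' => /negbTE ->.
apply: eq_bigr => T _; rewrite -big_distrr /= -[RHS]mulr1; congr (_ * _).
pose F (s : leaf T) (v : onehot K) :=
  \prod_(k < K) (r (val s) k / \sum_j r (val s) j) ^+ val v k.
rewrite -(bigA_distr_bigA F); apply: big1 => s _.
by rewrite sum_onehot -big_distrl /= divff// gt_eqF// sum_weight_gt0.
Qed.

End Recursion.

(** * Measurability of logarithms, matrix products and Gaussian densities *)

Section MeasurabilityTools.
Context d (T : measurableType d) (R : realType).

Lemma measurable_lne_EFin (f : T -> R) :
  measurable_fun setT f -> measurable_fun setT (fun x => lne (f x)%:E).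
Proof.
move=> mf; apply: measurable_fun_ifT => //=.
  by apply: measurable_fun_ler => //; exact: measurable_cst.
by apply/measurable_EFinP; apply: measurableT_comp => //; exact: measurable_ln.
Qed.

(** The default values agree: for [r <= 0], [lne] is -oo, which [fine] sends to 0, and [ln r] is 0
    too. *)
Lemma fine_lne_EFin (r : R) : fine (lne r%:E) = ln r.
Proof. by rewrite /=; case: ifPn => //= r_le0; rewrite ln0. Qed.

Lemma measurable_ln_of_lne (f : T -> R) :
  measurable_fun setT (fun x => lne (f x)%:E) ->
  measurable_fun setT (fun x => ln (f x)).
Proof.
move=> mf; under eq_fun do rewrite -fine_lne_EFin.
exact: (measurableT_comp (fine_measurable measurableT)).
Qed.

(** Serves to recover measurability of the likelihood from that of its logarithm. The indicator
    corrects [expR (ln 0) = 1] on the zero set of [f], where [lne] is -oo. *)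
Lemma measurable_of_lne (f : T -> R) : (forall x, 0 <= f x) ->
  measurable_fun setT (fun x => lne (f x)%:E) -> measurable_fun setT f.
Proof.
move=> f_ge0 mf.
have fE : f =
    (fun x => expR (ln (f x)) * \1_[set y | (-oo < lne (f y)%:E)%E] x).
  apply/funext => x; rewrite indicE /=.
  have [fx_le0|fx_gt0] := leP (f x) 0.
    rewrite memNset ?mulr0 /=; last by rewrite fx_le0.
    by apply/eqP; rewrite eq_le fx_le0 f_ge0.
  by rewrite mem_set ?mulr1 ?lnK// /= leNgt fx_gt0 ltNyr.
rewrite fE; apply: measurable_funM.
  by apply: measurableT_comp => //; exact: measurable_ln_of_lne.
apply: measurable_indic; rewrite -[X in measurable X]setTI.
exact: emeasurable_fun_o_infty.
Qed.

Lemma measurable_sqrt (f : T -> R) :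
  measurable_fun setT f -> measurable_fun setT (fun x => Num.sqrt (f x)).
Proof.
move=> mf; apply: measurableT_comp => //; apply: continuous_measurable_fun.
exact: sqrt_continuous.
Qed.

Lemma measurable_mulmx m n p (A : T -> 'M[R]_(m, n)) (B : T -> 'M[R]_(n, p)) :
  (forall i j, measurable_fun setT (fun x => A x i j)) ->
  (forall i j, measurable_fun setT (fun x => B x i j)) ->
  forall i j, measurable_fun setT (fun x => (A x *m B x) i j).
Proof.
move=> mA mB i j; under eq_fun do rewrite mxE.
by apply: measurable_sum => k; exact: measurable_funM.
Qed.

(** A negative [y] gives 0 on both sides. Such values occur because [param_space] contains all real
    values of tau. *)
Lemma sqrtrV_total (y : R) : (Num.sqrt y)^-1 = Num.sqrt y^-1.
Proof.
have [y_ge0|y_lt0] := leP 0 y; first by rewrite sqrtrV.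
by rewrite !ler0_sqrtr ?invr0// ?invr_le0 ltW.
Qed.

Lemma measurable_mvgauss n (m : 'cV[R]_n) (A : 'M[R]_n) (c : T -> R)
    (y : T -> 'cV[R]_n) :
  measurable_fun setT c ->
  (forall i j, measurable_fun setT (fun x => y x i j)) ->
  measurable_fun setT (fun x => mvgauss m (invmx (c x *: A)) (y x)).
Proof.
move=> mc my; rewrite /mvgauss.
have my' i j : measurable_fun setT (fun x => (y x - m) i j).
  under eq_fun do rewrite !mxE.
  by apply: measurable_funB => //; exact: measurable_cst.
apply: measurable_funM.
  (* Inverting the determinant of the covariance leaves a polynomial in [c x] under the root. *)
  under eq_fun do rewrite sqrtrV_total det_inv detZ invfM invrK.
  apply: measurable_sqrt; apply: measurable_funM; first exact: measurable_cst.
  by apply: measurable_funM; [exact: measurable_funX|exact: measurable_cst].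
apply: measurableT_comp => //; apply: measurable_funN.
apply: measurable_funM; first exact: measurable_cst.
apply: measurable_mulmx => //; apply: measurable_mulmx => i j.
  by under eq_fun do rewrite mxE; exact: my'.
under eq_fun do rewrite invmxK mxE.
by apply: measurable_funM => //; exact: measurable_cst.
Qed.

End MeasurabilityTools.

(** * Real-valued integrals: linearity and finiteness *)

Section HasIntegral.
Context d (T : measurableType d) (R : realType) (mu : probability T R).
Implicit Types (f : T -> R) (v : R).

Definition has_integral f v : Prop :=
  mu.-integrable setT (EFin \o f) /\ (\int[mu]_x (f x)%:E = v%:E)%E.

Lemma has_integral_cst v : has_integral (cst v) v.
Proof.
split; first exact: finite_measure_integrable_cst.
apply: etrans (integral_cst mu measurableT v%:E) _.
by rewrite -[RHS]mule1; congr (_ * _)%E; exact: probability_setT.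
Qed.

Lemma has_integralD f f' v v' : has_integral f v -> has_integral f' v' ->
  has_integral (fun x => f x + f' x) (v + v').
Proof.
move=> [fi fE] [fi' fE']; split; first exact: (integrableD measurableT fi fi').
under eq_integral do rewrite EFinD.
by rewrite integralD// fE fE'.
Qed.

Lemma has_integralZ f v a :
  has_integral f v -> has_integral (fun x => a * f x) (a * v).
Proof.
move=> [fi fE]; split; first exact: (integrableZl measurableT a fi).
under eq_integral do rewrite EFinM.
by rewrite integralZl// fE.
Qed.

Lemma has_integral_sum (I : Type) (s : seq I) (f : I -> T -> R) (v : I -> R) :
  (forall i, has_integral (f i) (v i)) ->
  has_integral (fun x => \sum_(i <- s) f i x) (\sum_(i <- s) v i).
Proof.
move=> fv; elim: s => [|i s IH].
  by rewrite big_nil; under eq_fun do rewrite big_nil; exact: has_integral_cst.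
by rewrite big_cons; under eq_fun do rewrite big_cons; exact: has_integralD.
Qed.

(** The integral is the difference of those of the positive and negative parts, so a finite value
    forces both to be finite. *)
Lemma integrable_of_fin_num (F : T -> \bar R) : measurable_fun setT F ->
  (\int[mu]_x F x)%E \is a fin_num -> mu.-integrable setT F.
Proof.
move=> mF; rewrite integralE fin_numB => /andP[pos_fin neg_fin].
apply/integrableP; split=> //.
have -> : (\int[mu]_x `|F x| = \int[mu]_x (F^\+ x + F^\- x))%E.
  by apply: eq_integral => x _; exact: (congr1 (@^~ x) (fune_abse F)).
rewrite ge0_integralD//; [|exact: measurable_funepos|exact: measurable_funeneg].
by rewrite lte_add_pinfty// ltey_eq ?pos_fin ?neg_fin.
Qed.

End HasIntegral.

(** * Expectations of logarithms under marginals *)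

Section Pushforward.
Context d1 d2 (X : measurableType d1) (Y : measurableType d2) (R : realType).
Variables (mu : probability X R) (phi : X -> Y) (f : Y -> R).
Hypothesis mphi : measurable_fun setT phi.
Hypothesis fi : (pushforward mu phi).-integrable setT (fun y => lne (f y)%:E).

Let comp_integrable : mu.-integrable setT (fun x => lne (f (phi x))%:E).
Proof.
have /integrableP[mf foo] := fi; apply/integrableP; split.
  exact: (measurableT_comp mf mphi).
move: foo; rewrite (ge0_integral_pushforward mphi)//.
exact: measurableT_comp.
Qed.

(** An integrable function is finite almost everywhere, whereas [lne] is -oo at nonpositive
    arguments. *)
Lemma pushforward_lne_gt0 : {ae mu, forall x, 0 < f (phi x)}.
Proof.
have := integrable_ae measurableT comp_integrable; apply: filterS => x /(_ I).
by rewrite /=; case: (leP _ 0).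
Qed.

Lemma integral_pushforward_lne :
  (\int[pushforward mu phi]_y lne (f y)%:E = \int[mu]_x lne (f (phi x))%:E)%E.
Proof.
have /integrableP[mf _] := fi.
exact: (integral_pushforward mphi mf comp_integrable).
Qed.

Lemma pushforward_lne_fin_num :
  (\int[pushforward mu phi]_y lne (f y)%:E)%E \is a fin_num.
Proof.
rewrite integral_pushforward_lne.
exact: (integrable_fin_num measurableT comp_integrable).
Qed.

(** Passes from [lne] to the real [ln]: they agree where [f] is positive, hence almost surely, and
    elsewhere [ln] is 0. *)
Lemma pushforward_lne_has_integral :
  has_integral mu (fun x => ln (f (phi x)))
    (fine (\int[pushforward mu phi]_y lne (f y)%:E)%E).
Proof.
have /integrableP[mfphi _] := comp_integrable.
have mln : measurable_fun setT (EFin \o (fun x => ln (f (phi x)))).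
  by apply/measurable_EFinP; exact: measurable_ln_of_lne.
split.
  apply: le_integrable comp_integrable => // x _ /=.
  by case: ifPn => [fx_le0|//]; rewrite ln0// normr0 leey.
rewrite fineK ?pushforward_lne_fin_num// integral_pushforward_lne.
apply: ae_eq_integral => //; have := pushforward_lne_gt0.
by apply: filterS => x fx_gt0 _; rewrite lne_EFin.
Qed.

End Pushforward.

(** * Weighted sums of integrals under an integrable shift of the integrands *)

Section Tilting.
Context d (T : measurableType d) (R : realType) (mu : probability T R).
Variables (I : finType) (w : I -> R) (H0 H1 : I -> T -> \bar R).
Variables (f : I -> T -> R) (v : I -> R) (C y0 : R).
Hypothesis w_ge0 : forall i, 0 <= w i.
Hypotheses (mH0 : forall i, measurable_fun setT (H0 i)).
Hypotheses (mH1 : forall i, measurable_fun setT (H1 i)).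
Hypothesis fv : forall i, has_integral mu (f i) (v i).
Hypothesis H01 : forall i, {ae mu, forall x, H1 i x = (H0 i x + (f i x)%:E)%E}.
Hypothesis H0E : (\sum_i (w i)%:E * \int[mu]_x H0 i x + C%:E = y0%:E)%E.

(* The finite value y0 forces H0 i to be integrable whenever w i != 0. *)
Lemma tilted_sum :
  (\sum_i (w i)%:E * \int[mu]_x H1 i x + C%:E = (y0 + \sum_i w i * v i)%:E)%E.
Proof.
have /sum_fin_numP finH0 :
    (\sum_i (w i)%:E * \int[mu]_x H0 i x)%E \is a fin_num.
  by have : y0%:E \is a fin_num by []; rewrite -H0E fin_numD => /andP[].
have H1E i : ((w i)%:E * \int[mu]_x H1 i x =
    (w i)%:E * \int[mu]_x H0 i x + (w i * v i)%:E)%E.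
  (* With weight 0 the integral may be infinite, but 0 times an infinite value is 0. *)
  have [->|wi_neq0] := eqVneq (w i) 0; first by rewrite !mul0e mul0r add0e.
  have wi_gt0 : 0 < w i by rewrite lt_neqAle eq_sym wi_neq0 w_ge0.
  have H0_fin : (\int[mu]_x H0 i x)%E \is a fin_num.
    have := finH0 i (mem_index_enum _) isT.
    case: (\int[mu]_x H0 i x)%E => [//| |].
      by rewrite gt0_muley.
    by rewrite gt0_muleNy.
  have [fi fE] := fv i.
  have H0i := integrable_of_fin_num (mH0 i) H0_fin.
  rewrite (@ae_eq_integral _ _ _ _ _ (fun x => H0 i x + (f i x)%:E)%E)//.
  - by rewrite integralD// fE muleDr ?fin_num_adde_defr// EFinM.
  - by have /integrableP[] := integrableD measurableT H0i fi.
  - by have := H01 i; apply: filterS.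
under eq_bigr do rewrite H1E.
by rewrite big_split /= sumEFin addeAC H0E.
Qed.

End Tilting.

(** * Logarithms of products, and path probabilities *)

Lemma ln_prod (R : realType) (I : Type) (s : seq I) (F : I -> R) :
  (forall i, 0 < F i) -> ln (\prod_(i <- s) F i) = \sum_(i <- s) ln (F i).
Proof.
move=> F_gt0; elim: s => [|i s IH]; first by rewrite !big_nil ln1.
by rewrite !big_cons lnM ?posrE ?prodr_gt0// IH.
Qed.

(** For [b <= 0] both sides are -oo, so a positive factor can be split off whatever the sign of the
    rest. *)
Lemma lne_pmul (R : realType) (a b : R) : 0 < a ->
  (lne (a * b)%:E = (ln a)%:E + lne b%:E)%E.
Proof.
move=> a_gt0; rewrite /= pmulr_rle0//; case: ifPn => //.
rewrite -ltNge => b_gt0.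
by rewrite lnM ?posrE.
Qed.

Lemma q_pathE (R : realType) (Dmax n : nat) (qu : paths Dmax n -> R)
    (s : node Dmax) (t : 'I_n) :
  q_path qu s t = \sum_u qu u * (prefix s (reached_leaf (u t)))%:R.
Proof.
rewrite (partition_big (fun u : paths Dmax n => u t) xpredT)//=.
apply: eq_bigr => v _; rewrite /marg_u big_distrl /=.
by apply: eq_bigr => u /eqP ->.
Qed.

(** * Measurability of the model densities *)

Section Densities.
Variables (R : realType) (Dmax n K D : nat).
Local Notation param := (param_space R Dmax K D).

Lemma measurable_get_thetatau :
  measurable_fun setT (@get_thetatau R Dmax K D).
Proof. exact: (measurableT_comp measurable_fst measurable_fst). Qed.

Lemma measurable_get_pi : measurable_fun setT (@get_pi R Dmax K D).
Proof. exact: (measurableT_comp measurable_snd measurable_fst). Qed.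

Lemma measurable_pi_k k :
  measurable_fun setT (fun w : param => pi_k (get_pi w) k).
Proof. exact: (measurableT_comp (measurable_tnth k) measurable_get_pi). Qed.

Lemma measurable_tau_k k :
  measurable_fun setT (fun w : param => tau_k (get_thetatau w) k).
Proof.
apply: (measurableT_comp (measurable_tnth k)).
exact: (measurableT_comp measurable_snd measurable_get_thetatau).
Qed.

Lemma measurable_theta_k k i j :
  measurable_fun setT (fun w : param => theta_k (get_thetatau w) k i j).
Proof.
under eq_fun do rewrite mxE.
apply: (measurableT_comp (measurable_tnth i)).
apply: (measurableT_comp (measurable_tnth k)).
exact: (measurableT_comp measurable_fst measurable_get_thetatau).
Qed.

Lemma measurable_beta_s s i j :
  measurable_fun setT (fun w : param => beta_s w s i j).
Proof.
under eq_fun do rewrite mxE.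
apply: (measurableT_comp (measurable_tnth i)).
exact: (measurableT_comp (measurable_tnth (enum_rank s)) measurable_snd).
Qed.

Lemma measurable_dirichlet_pdf (alpha : 'I_K -> R) :
  measurable_fun setT (fun w : param => dirichlet_pdf alpha (pi_k (get_pi w))).
Proof.
apply: measurable_funM; first exact: measurable_cst.
apply: measurable_prod => k _.
exact: (measurableT_comp (measurable_powR _) (measurable_pi_k k)).
Qed.

Lemma measurable_p_thetatau mu Lambda a b :
  measurable_fun setT (@p_thetatau R Dmax K D mu Lambda a b).
Proof.
apply: measurable_prod => k _; apply: measurable_funM.
  apply: measurable_mvgauss => *; first exact: measurable_tau_k.
  exact: measurable_theta_k.
have mtau := measurable_tau_k k.
apply: measurable_funM; last first.
  apply: measurableT_comp => //; apply: measurable_funN.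
  by apply: measurable_funM => //; exact: measurable_cst.
apply: measurable_funM; first exact: measurable_cst.
exact: (measurableT_comp (measurable_powR _)).
Qed.

Lemma measurable_p_beta eta L : measurable_fun setT (@p_beta R Dmax K D eta L).
Proof.
apply: measurable_prod => s _; rewrite -[L s]scale1r.
apply: measurable_mvgauss => *; first exact: measurable_cst.
exact: measurable_beta_s.
Qed.

Lemma measurable_h_bound (xi : inode Dmax -> 'I_n -> R) (u : paths Dmax n) :
  measurable_fun setT (@h_bound R Dmax n K D xi u).
Proof.
apply: measurable_prod => t _; apply: measurable_prod => s _.
apply: measurable_funX; apply: measurable_funM; first exact: measurable_cst.
have mbt : measurable_fun setT
    (fun w : param => ((beta_s w s)^T *m time_vec R t) 0 0).
  apply: measurable_mulmx => i j; last exact: measurable_cst.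
  by under eq_fun do rewrite mxE; exact: measurable_beta_s.
apply: measurableT_comp => //; apply: measurable_funB.
  apply: measurable_funB.
    by apply: measurable_funM => //; exact: measurable_cst.
  apply: measurable_funM; first exact: measurable_cst.
  by apply: measurable_funD => //; exact: measurable_cst.
apply: measurable_funM; first exact: measurable_cst.
apply: measurable_funB; last exact: measurable_cst.
exact: measurable_funX.
Qed.

End Densities.

(** * Logarithm of the configuration-dependent factors and its mean *)

Section Posterior.
Variables (R : realType) (Dmax n K D : nat) (x : int -> R).
Variables (g : node Dmax -> R) (alpha : 'I_K -> R).
Variables (mu : 'cV[R]_D.+1) (Lambda : 'M[R]_D.+1) (a b : R).
Variables (eta : inode Dmax -> 'cV[R]_2) (L : inode Dmax -> 'M[R]_2).
Variables (xi : inode Dmax -> 'I_n -> R) (qu : paths Dmax n -> R).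
Variable qpar : probability (param_space R Dmax K D) R.
Local Notation param := (param_space R Dmax K D).
Hypothesis hg : forall s, 0 <= g s <= 1.
Hypothesis hpi : forall k : 'I_K,
  (marg_pi qpar).-integrable setT (fun p => lne (pi_k p k)%:E).
Hypothesis hlik : forall (t : 'I_n) (k : 'I_K),
  (marg_thetatau qpar).-integrable setT (fun tt => lne (lik x t k tt)%:E).

Let P (k : 'I_K) : R := fine (\int[marg_pi qpar]_p lne (pi_k p k)%:E)%E.
Let M (t : 'I_n) (k : 'I_K) : R :=
  fine (\int[marg_thetatau qpar]_tt lne (lik x t k tt)%:E)%E.
Let r := rho qu qpar x.

Lemma lik_ge0 (t : 'I_n) (k : 'I_K) (tt : thetatau_space R K D) :
  0 <= lik x t k tt.
Proof. exact: normal_pdf_ge0. Qed.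

Lemma measurable_lik (t : 'I_n) (k : 'I_K) :
  measurable_fun setT (fun w : param => lik x t k (get_thetatau w)).
Proof.
have /integrableP[mlik _] := hlik t k.
have := measurable_of_lne (@lik_ge0 t k) mlik.
by move=> /measurableT_comp; apply; exact: measurable_get_thetatau.
Qed.

Lemma ln_rhoE s k :
  ln_rho qu qpar x s k = (P k + \sum_t q_path qu s t * M t k)%:E.
Proof.
rewrite EFinD -sumEFin /ln_rho; congr (_ + _)%E.
  rewrite /P fineK//.
  exact: pushforward_lne_fin_num (@measurable_get_pi _ _ _ _) (hpi k).
apply: eq_bigr => t _; rewrite EFinM /M fineK//.
exact: pushforward_lne_fin_num (@measurable_get_thetatau _ _ _ _) (hlik t k).
Qed.

Lemma rho_gt0 s k : 0 < r s k.
Proof. by rewrite /r /rho ln_rhoE /= expR_gt0. Qed.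

Lemma tree_prior_ge0 (T : tree Dmax) : 0 <= tree_prior g T.
Proof.
apply: mulr_ge0; apply: prodr_ge0 => s _; have /andP[] := hg s => //.
by rewrite subr_ge0.
Qed.

Section Configuration.
Variables (T : tree Dmax) (z : latent K T).

Definition config_weight (u : paths Dmax n) (w : param) : R :=
  p_x x u z w * p_z z w * tree_prior g T.

(** The factors free of (z, T), which are common to any two configurations being compared. *)
Definition context_weight (u : paths Dmax n) (w : param) : R :=
  dirichlet_pdf alpha (pi_k (get_pi w)) * p_thetatau mu Lambda a b w *
  h_bound xi u w * p_beta eta L w.

Lemma jointE u w :
  joint x g alpha mu Lambda a b u z w * h_bound xi u w * p_beta eta L w =
  config_weight u w * context_weight u w.
Proof. by rewrite /joint /config_weight /context_weight; ring. Qed.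

Lemma measurable_joint u : measurable_fun setT (fun w : param =>
  joint x g alpha mu Lambda a b u z w * h_bound xi u w * p_beta eta L w).
Proof.
under eq_fun do rewrite jointE.
apply: measurable_funM; last first.
  apply: measurable_funM; last exact: measurable_p_beta.
  apply: measurable_funM; last exact: measurable_h_bound.
  apply: measurable_funM; last exact: measurable_p_thetatau.
  exact: measurable_dirichlet_pdf.
apply: measurable_funM; last exact: measurable_cst.
apply: measurable_funM.
  apply: measurable_prod => t _; apply: measurable_prod => s _.
  apply: measurable_prod => k _; apply: measurable_funX.
  exact: measurable_lik.
apply: measurable_prod => s _; apply: measurable_prod => k _.
by apply: measurable_funX; exact: measurable_pi_k.
Qed.

Definition config_exponent (u : paths Dmax n) (w : param) : R :=
  (\sum_(t < n) \sum_(s : leaf T) \sum_(k < K)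
    (val (z s) k * prefix (val s) (reached_leaf (u t)))%N%:R *
      ln (lik x t k (get_thetatau w))) +
  \sum_(s : leaf T) \sum_(k < K) (val (z s) k)%:R * ln (pi_k (get_pi w) k).

Definition mean_exponent (u : paths Dmax n) : R :=
  (\sum_(t < n) \sum_(s : leaf T) \sum_(k < K)
    (val (z s) k * prefix (val s) (reached_leaf (u t)))%N%:R * M t k) +
  \sum_(s : leaf T) \sum_(k < K) (val (z s) k)%:R * P k.

Lemma config_exponent_has_integral u :
  has_integral qpar (config_exponent u) (mean_exponent u).
Proof.
apply: has_integralD.
  do 3 (apply: has_integral_sum => ?); apply: has_integralZ.
  apply: pushforward_lne_has_integral (hlik _ _).
  exact: measurable_get_thetatau.
do 2 (apply: has_integral_sum => ?); apply: has_integralZ.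
apply: pushforward_lne_has_integral (hpi _).
exact: measurable_get_pi.
Qed.

(** Finite expected logarithms make each [lik] and [pi_k] almost surely positive. Only finitely many
    of them occur, so a single null set serves all [u]. *)
Lemma config_weight_ae : 0 < tree_prior g T ->
  {ae qpar, forall w, forall u, 0 < config_weight u w /\
    ln (config_weight u w) = config_exponent u w + ln (tree_prior g T)}.
Proof.
move=> prior_gt0.
have lik_gt0 : {ae qpar, forall w, forall i : 'I_n * 'I_K,
    0 < lik x i.1 i.2 (get_thetatau w)}.
  apply: filter_forall => i.
  exact: pushforward_lne_gt0 (@measurable_get_thetatau _ _ _ _) (hlik _ _).
have pi_gt0 : {ae qpar, forall w, forall k, 0 < pi_k (get_pi w) k}.
  apply: filter_forall => k.
  exact: pushforward_lne_gt0 (@measurable_get_pi _ _ _ _) (hpi _).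
apply: filterS2 lik_gt0 pi_gt0 => w l_gt0 p_gt0 u.
have {}l_gt0 t k : 0 < lik x t k (get_thetatau w) := l_gt0 (t, k).
have px_gt0 : 0 < p_x x u z w.
  by do 3 (apply: prodr_gt0 => ? _); exact: exprn_gt0.
have pz_gt0 : 0 < p_z z w.
  by do 2 (apply: prodr_gt0 => ? _); exact: exprn_gt0.
have pxz_gt0 := mulr_gt0 px_gt0 pz_gt0.
rewrite /config_weight; split; first exact: mulr_gt0.
rewrite lnM ?posrE// lnM ?posrE//.
congr (_ + _ + _); rewrite ln_prod.
- apply: eq_bigr => t _; rewrite ln_prod; last first.
    by move=> s; apply: prodr_gt0 => k _; exact: exprn_gt0.
  apply: eq_bigr => s _; rewrite ln_prod; last by move=> k; exact: exprn_gt0.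
  by apply: eq_bigr => k _; rewrite lnXn// mulr_natl.
- by move=> t; do 2 (apply: prodr_gt0 => ? _); exact: exprn_gt0.
- apply: eq_bigr => s _; rewrite ln_prod; last by move=> k; exact: exprn_gt0.
  by apply: eq_bigr => k _; rewrite lnXn// mulr_natl.
- by move=> s; apply: prodr_gt0 => k _; exact: exprn_gt0.
Qed.

Lemma latent_weight_gt0 : 0 < latent_weight r z.
Proof. by do 2 (apply: prodr_gt0 => ? _); rewrite exprn_gt0// rho_gt0. Qed.

(** Averaging over [u] turns the path indicators into [q_path], and the coefficient of each z_{s,k}
    becomes ln rho_{s,k}. *)
Lemma ln_latent_weight : \sum_u qu u = 1 ->
  ln (latent_weight r z) = \sum_u qu u * mean_exponent u.
Proof.
move=> qu1; under [RHS]eq_bigr do rewrite mulrDr.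
rewrite big_split /= -big_distrl /= qu1 mul1r.
have lnr s k : ln (r s k) = P k + \sum_t q_path qu s t * M t k.
  by rewrite /r /rho ln_rhoE /= expRK.
rewrite ln_prod; last first.
  by move=> s; apply: prodr_gt0 => k _; rewrite exprn_gt0// rho_gt0.
(* The sums are exchanged until the one over [u] is innermost, where [q_pathE] applies. *)
have -> : \sum_u qu u * \sum_t \sum_(s : leaf T) \sum_k
      (val (z s) k * prefix (val s) (reached_leaf (u t)))%N%:R * M t k =
    \sum_(s : leaf T) \sum_k \sum_t
      (val (z s) k)%:R * (q_path qu (val s) t * M t k).
  under eq_bigr do rewrite big_distrr /=.
  rewrite exchange_big /=.
  under eq_bigr do under eq_bigr do rewrite big_distrr /=.
  under eq_bigr do rewrite exchange_big /=.
  rewrite exchange_big /=; apply: eq_bigr => s _.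
  under eq_bigr do under eq_bigr do rewrite big_distrr /=.
  under eq_bigr do rewrite exchange_big /=.
  rewrite exchange_big /=; apply: eq_bigr => k _; apply: eq_bigr => t _.
  rewrite q_pathE big_distrl big_distrr /=; apply: eq_bigr => u _.
  by rewrite natrM; ring.
rewrite -big_split /=; apply: eq_bigr => s _.
rewrite ln_prod; last by move=> k; rewrite exprn_gt0// rho_gt0.
rewrite -big_split /=; apply: eq_bigr => k _.
rewrite lnXn ?rho_gt0// lnr -[LHS]mulr_natl mulrDr addrC; congr (_ + _).
by rewrite big_distrr.
Qed.

End Configuration.

(** * Proportionality of q(z, T) to the prior times the latent weight *)

Section Proportionality.
Hypotheses (hqu0 : forall u, 0 <= qu u) (hqu1 : \sum_u qu u = 1).
Variable q : forall T : tree Dmax, latent K T -> R.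
Hypothesis hq0 : forall (T : tree Dmax) (z : latent K T), 0 <= q z.
Variables (c : paths Dmax n -> param -> R) (C : R).
Hypothesis mc : forall u, measurable_fun setT (c u).
Let integrand (T : tree Dmax) (z : latent K T) u (w : param) : \bar R :=
  (lne (joint x g alpha mu Lambda a b u z w * h_bound xi u w
          * p_beta eta L w)%:E - (c u w)%:E)%E.
Hypothesis hq : forall (T : tree Dmax) (z : latent K T),
  (lne (q z)%:E = \sum_u (qu u)%:E * \int[qpar]_w integrand z u w + C%:E)%E.

(** If p(T) were 0, the integrand would be -oo everywhere; some [u] has positive mass, so ln q(z, T)
    could not be finite. *)
Lemma tree_prior_gt0 (T : tree Dmax) (z : latent K T) :
  q z != 0 -> 0 < tree_prior g T.
Proof.
move=> qz_neq0; have qz_gt0 : 0 < q z by rewrite lt_neqAle eq_sym qz_neq0 hq0.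
rewrite lt_neqAle tree_prior_ge0 andbT eq_sym; apply/negP => /eqP prior0.
have integrandE u w : integrand z u w = -oo%E.
  by rewrite /integrand jointE /config_weight prior0 mulr0 mul0r /= lexx.
have /existsP[u qu_neq0] : [exists u, qu u != 0].
  apply: contraT; rewrite negb_exists => /forallP qu0.
  suff : \sum_u qu u == 0 by rewrite hqu1 oner_eq0.
  by rewrite big1// => u _; apply/eqP; rewrite -[_ == _]negbK qu0.
have qu_gt0 : 0 < qu u by rewrite lt_neqAle eq_sym qu_neq0 hqu0.
have : lne (q z)%:E \is a fin_num by rewrite lne_EFin.
rewrite hq fin_numD => /andP[/sum_fin_numP/(_ u (mem_index_enum _) isT) + _].
have -> : (\int[qpar]_w integrand z u w = -oo)%E.
  under eq_integral do rewrite integrandE.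
  apply: etrans (integral_cst qpar measurableT -oo%E) _.
  by rewrite -[RHS]mule1; congr (_ * _)%E; exact: probability_setT.
by rewrite gt0_muleNy.
Qed.

Lemma q_proportional (T0 T : tree Dmax) (z0 : latent K T0) (z : latent K T) :
  q z0 != 0 ->
  q z = q z0 / (tree_prior g T0 * latent_weight r z0) *
    (tree_prior g T * latent_weight r z).
Proof.
move=> q0_neq0; have prior0_gt0 := tree_prior_gt0 q0_neq0.
have q0_gt0 : 0 < q z0 by rewrite lt_neqAle eq_sym q0_neq0 hq0.
(* If p(T) = 0, both sides vanish, the left one by the contrapositive of [tree_prior_gt0]. *)
have [prior_gt0|prior_le0] := ltP 0 (tree_prior g T); last first.
  have -> : tree_prior g T = 0.
    by apply/eqP; rewrite eq_le prior_le0 tree_prior_ge0.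
  rewrite mul0r mulr0; apply/eqP; apply: contraTT prior_le0.
  by rewrite -ltNge; exact: tree_prior_gt0.
(* [f] is almost surely the logarithm of the ratio of the two configuration weights, and [v] is its
   mean under [qpar]. *)
pose f u w := config_exponent z u w - config_exponent z0 u w +
  (ln (tree_prior g T) - ln (tree_prior g T0)).
pose v u := mean_exponent z u - mean_exponent z0 u +
  (ln (tree_prior g T) - ln (tree_prior g T0)).
have fv u : has_integral qpar (f u) (v u).
  apply: has_integralD; last exact: has_integral_cst.
  rewrite -mulN1r; under eq_fun do rewrite -mulN1r.
  apply: has_integralD; first exact: config_exponent_has_integral.
  by apply: has_integralZ; exact: config_exponent_has_integral.
have mintegrand (T' : tree Dmax) (z' : latent K T') u :
    measurable_fun setT (integrand z' u).
  apply: emeasurable_funB; last exact/measurable_EFinP.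
  by apply: measurable_lne_EFin; exact: measurable_joint.
have integrand_ae u : {ae qpar, forall w,
    integrand z u w = (integrand z0 u w + (f u w)%:E)%E}.
  apply: filterS2 (config_weight_ae z prior_gt0)
    (config_weight_ae z0 prior0_gt0).
  move=> w /(_ u)[A_gt0 lnA] /(_ u)[A0_gt0 lnA0].
  rewrite /integrand !jointE (lne_pmul _ A_gt0) (lne_pmul _ A0_gt0) lnA lnA0 /=.
  (* Where the context weight is not positive, both integrands are -oo. *)
  by case: ifP => // _; rewrite /f -!EFinD; congr EFin; ring.
have H0 : (\sum_u (qu u)%:E * \int[qpar]_w integrand z0 u w + C%:E =
    (ln (q z0))%:E)%E by rewrite -hq lne_EFin.
have := tilted_sum hqu0 (mintegrand _ z0) (mintegrand _ z) fv integrand_ae H0.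
rewrite -hq.
have -> : \sum_u qu u * v u = ln (latent_weight r z) - ln (latent_weight r z0) +
    (ln (tree_prior g T) - ln (tree_prior g T0)).
  rewrite !ln_latent_weight// -sumrB -[X in _ + X]mul1r -hqu1 big_distrl /=.
  by rewrite -big_split /=; apply: eq_bigr => u _; rewrite /v; ring.
have W_gt0 := latent_weight_gt0 z; have W0_gt0 := latent_weight_gt0 z0.
(* The right side is a real number, which rules out [lne (q z) = -oo]; exponentiating then gives the
   claim. *)
rewrite /=; case: leP => // q_gt0 [lnq].
rewrite -[LHS]lnK ?posrE// lnq !(expRD, expRN) !lnK ?posrE//.
by field; rewrite !gt_eqF.
Qed.

End Proportionality.
End Posterior.

Theorem lemma2 (R : realType) (Dmax n K D : nat) (hDmax : (0 < Dmax)%N)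
  (x : int -> R)
  (g : node Dmax -> R)
  (hg : forall s, 0 <= g s <= 1)
  (hgleaf : forall s, s \in Lmax Dmax -> g s = 0)
  (alpha : 'I_K -> R) (halpha : forall k, 0 < alpha k)
  (mu : 'cV[R]_D.+1) (Lambda : 'M[R]_D.+1) (hLambda : posdef Lambda)
  (a b : R) (ha : 0 < a) (hb : 0 < b)
  (eta : inode Dmax -> 'cV[R]_2) (L : inode Dmax -> 'M[R]_2)
  (hL : forall s, posdef (L s))
  (xi : inode Dmax -> 'I_n -> R)
  (* q(u) *)
  (qu : paths Dmax n -> R)
  (hqu0 : forall u, 0 <= qu u) (hqu1 : \sum_(u : paths Dmax n) qu u = 1)
  (* q(theta, tau, pi, beta) *)
  (qpar : probability (param_space R Dmax K D) R)
  (hqpar : {ae qpar, forall w, admissible w})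
  (hpi : forall k : 'I_K,
     (marg_pi qpar).-integrable setT (fun p => lne (pi_k p k)%:E))
  (hlik : forall (t : 'I_n) (k : 'I_K),
     (marg_thetatau qpar).-integrable setT (fun tt => lne (lik x t k tt)%:E))
  (* q(z, T) *)
  (q : forall T : tree Dmax, latent K T -> R)
  (hq0 : forall (T : tree Dmax) (z : latent K T), 0 <= q T z)
  (hq1 : \sum_(T : tree Dmax) \sum_(z : latent K T) q T z = 1)
  (* The log-factors free of (z, T) that are absorbed into the additive
     constant are collected in c; c = 0 leaves the whole joint inside. *)
  (hq : exists (c : paths Dmax n -> param_space R Dmax K D -> R) (C : R),
     (forall u, measurable_fun setT (c u)) /\
     forall (T : tree Dmax) (z : latent K T),
       (lne (q T z)%:E =
        \sum_(u : paths Dmax n) (qu u)%:E *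
          \int[qpar]_w
            (lne (joint x g alpha mu Lambda a b u z w * h_bound xi u w
                    * p_beta eta L w)%:E - (c u w)%:E) + C%:E)%E) :
  let r := rho qu qpar x in
  forall (T : tree Dmax) (z : latent K T),
    q T z = ((\prod_(s in inners T) g' g r s) *
           (\prod_(s in leaves T) (1 - g' g r s))) *
          \prod_(s : leaf T) \prod_(k < K) pi' qu qpar x (val s) k ^+ val (z s) k.
Proof.
(* As [q] sums to 1, it is nonzero at some (T0, z0). The one-hot vector at a leaf of [T0] has an
   index in ['I_K], so [K] is positive. *)
have hposK : (0 < K)%N /\
    exists (T0 : tree Dmax) (z0 : latent K T0), q T0 z0 != 0.
  have /existsP[T0 /existsP[z0 q0]] :
      [exists T, [exists z : latent K T, q T z != 0]].
    apply: contraT => /existsPn q0.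
    suff : \sum_T \sum_(z : latent K T) q T z == 0 by rewrite hq1 oner_eq0.
    rewrite big1// => T _; rewrite big1// => z _; apply/eqP.
    by have /existsPn/(_ z) := q0 T; rewrite negbK.
  split; last by exists T0, z0.
  have [s sT0] := leaves_nonempty T0.
  by have [[k ltkK] _] := onehotP (z0 (exist _ s sT0)); apply: leq_trans ltkK.
move: hposK hq => [K_gt0 [T0 [z0 q0_neq0]]] [c [C [mc hqE]]] r.
have r_gt0 : forall s k, 0 < r s k by move=> s k; exact: rho_gt0.
set kappa := q T0 z0 / (tree_prior g T0 * latent_weight r z0).
have qE T (z : latent K T) : q T z = kappa * phi g r [bseq] * posterior g r z.
  rewrite (q_proportional hg hpi hlik hqu0 hqu1 hq0 mc hqE z q0_neq0).
  rewrite posteriorE// -/r -/kappa; field.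
  by rewrite gt_eqF// phi_gt0.
suff kappa1 : kappa * phi g r [bseq] = 1 by move=> T z; rewrite qE kappa1 mul1r.
have := hq1; under eq_bigr do under eq_bigr do rewrite qE.
under eq_bigr do rewrite -big_distrr.
by rewrite -big_distrr /= sum_posterior// mulr1.
Qed.
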